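(* For each positive integer $a$ let $$S(a)=\{n\in\mathbb{Z}: n>1,\ \gcd(a,n)=1,\ \text{and } n\neq p+ax^2 \text{ for any prime } p \text{ and any } x\in\mathbb{Z}\}.$$ Assume the following (conjectural) hypothesis: for every positive integer $a$ that is not a square the set $S(a)$ is finite; moreover $$S(6)=\emptyset,\quad S(12)=\{133\},\quad S(30)=\{121\},$$ $$S(3)=\{4,28,52,133,292,892,1588\},\quad S(18)=\{187,1003,5777,5993\},$$ $$S(24)=\{25,49,145,385,745,1081,1139,1561,2119,2449,5299\},$$ and $$\max S(5)=270086,\ \max S(7)=150457,\ \max S(8)=39167,\ \max S(10)=18031,\ \max S(11)=739676.$$ Then the sums $p_3+2p_4+p_9$ and $p_3+p_4+p_{13}$ are universal over $\mathbb{Z}$.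
   Context: $\mathbb{N}=\{0,1,2,\ldots\}$. For an integer $m\ge 3$ and $x\in\mathbb{Z}$, $p_m(x)=\frac{(m-2)x^2-(m-4)x}{2}$. For positive integers $a,b,c$ and integers $i,j,k\ge 3$, the sum $ap_i+bp_j+cp_k$ is called universal over $\mathbb{Z}$ if every $n\in\mathbb{N}$ can be written as $n=ap_i(x)+bp_j(y)+cp_k(z)$ with $x,y,z\in\mathbb{Z}$. The hypothesis in the claim is a conjecture; the result is conditional on it. *)

(* Defs.v *)
From Stdlib Require Import ZArith Znumtheory List Lia.
Import ListNotations.
Open Scope Z_scope.

(* The numerator is always even, so [/] is exact here; see [polygonal_double]. *)
Definition polygonal (m x : Z) : Z := ((m - 2) * x ^ 2 - (m - 4) * x) / 2.

Lemma polygonal_double (m x : Z) :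
  2 * polygonal m x = (m - 2) * x ^ 2 - (m - 4) * x.
Proof.
unfold polygonal; symmetry; apply Z_div_exact_2; [lia|].
assert (H : (m - 2) * x ^ 2 - (m - 4) * x
            = ((m - 2) * (x * (x - 1) / 2) + x) * 2).
{ assert (E : x * (x - 1) = 2 * (x * (x - 1) / 2)).
  { apply Z_div_exact_2; [lia|].
    rewrite Zmod_even, Z.even_mul, Z.even_sub.
    now destruct (Z.even x). }
  replace (x ^ 2) with (x * (x - 1) + x) by ring.
  rewrite E at 1; ring. }
rewrite H; apply Z_mod_mult.
Qed.

Definition universal (a b c i j k : Z) : Prop :=
  forall n : Z, 0 <= n -> exists x y z : Z,
    n = a * polygonal i x + b * polygonal j y + c * polygonal k z.

Definition exceptional (a : Z) (n : Z) : Prop :=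
  n > 1 /\ Z.gcd a n = 1 /\
  forall p x : Z, prime p -> n <> p + a * x ^ 2.

Definition is_square (a : Z) : Prop := exists b : Z, a = b ^ 2.

(* [A] is the set of elements of the list [l]. *)
Definition enumerated_by (A : Z -> Prop) (l : list Z) : Prop :=
  forall n : Z, A n <-> In n l.

Definition is_finite (A : Z -> Prop) : Prop := exists l : list Z, enumerated_by A l.

Definition is_max (A : Z -> Prop) (m : Z) : Prop :=
  A m /\ forall n : Z, A n -> n <= m.

(* Main.v *)
(** Completing squares, [n] is of the form [p_3 + 2 p_4 + p_9] as soon as
    [56 n + 32 = 7 x^2 + 112 y^2 + w^2] with [x] odd, and of the form
    [p_3 + p_4 + p_13] as soon as [88 n + 92 = 11 x^2 + 88 y^2 + w^2] with [x] odd.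
    If [56 n + 32] is not in [S(7)], write it as [p + 7 x^2]; congruences modulo 8
    and 7 force [x] odd, [p = 1 mod 8] and [p = 4 mod 7].  Then [-7] is a square modulo
    [p], so reduction of binary forms gives [p = w^2 + 7 v^2], and [4 | v] modulo 8.
    Likewise, if [88 n + 92] is not in [S(11)], it is [p + 11 x^2] with [p = 1 mod 8],
    [p = 4 mod 11], hence [-22] is a square modulo [p], [p = w^2 + 22 v^2], [v] even.
    The bounds on [S(7)] and [S(11)] leave finitely many [n], checked by computation. *)

From HB Require Import structures.
From mathcomp Require all_boot all_order all_algebra all_field ring.
From Stdlib Require Import ZArith Znumtheory List Lia Zwf Classical MSetPositive.
Require Import Defs.
Import ListNotations.
Open Scope Z_scope.

(** * Square roots of -7 and -22 modulo a prime, by Gauss sums *)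

Module QuadraticResidues.

Import all_boot all_order all_algebra all_field ring.
Import GRing.Theory.
Local Open Scope ring_scope.

(** Over [F], ['X^#|F| - 'X] is the product of the ['X - a], so all its roots in [K] are images of
    elements of [F]. *)
Lemma frobenius_fixed (F : finFieldType) (K : fieldType)
    (f : {rmorphism F -> K}) (x : K) : x ^+ #|F| = x -> exists c, x = f c.
Proof.
move=> Ex.
have : root (map_poly f ('X^#|F| - 'X)) x.
  by rewrite rmorphB /= map_polyXn map_polyX rootE !hornerE Ex subrr.
rewrite finField_genPoly rmorph_prod /=.
under eq_bigr => i _ do rewrite rmorphB /= map_polyX map_polyC /=.
rewrite -(big_map f xpredT (fun a => 'X - a%:P)) root_prod_XsubC.
by case/mapP => c _ ->; exists c.
Qed.

Lemma Fp_closure (p : nat) : prime p ->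
  exists (K : closedFieldType) (f : {rmorphism 'F_p -> K}), p \in [pchar K].
Proof.
move=> pr_p; have [K [f _]] := countable_algebraic_closure 'F_p.
by exists K, f; rewrite (fmorph_pchar f) pchar_Fp.
Qed.

(** Supplies, for [n + 2] equal to 7 or 11, the root of unity from which the Gauss sum is built. *)
Lemma root_exists (K : closedFieldType) (n : nat) : exists z : K, \sum_(i < n.+2) z ^+ i = 0.
Proof.
have : size (\poly_(i < n.+2) (1 : K)) != 1 by rewrite size_poly_eq ?oner_neq0.
case/closed_rootP=> z /rootP; rewrite horner_poly => Ez; exists z.
by rewrite -{}[RHS]Ez; apply: eq_bigr => i _; rewrite mul1r.
Qed.

Lemma cyclotomic_period (K : comNzRingType) (n : nat) (z : K) :
  \sum_(i < n) z ^+ i = 0 -> z ^+ n = 1.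
Proof. by move=> Ez; apply/eqP; rewrite -subr_eq0 subrX1 Ez mulr0. Qed.

Lemma dvdn_of_Fp (p : nat) (c : 'F_p) (d : nat) : prime p ->
  c ^+ 2 + d%:R = 0 -> (p %| c ^ 2 + d)%N.
Proof.
move=> pr_p Ec; rewrite (dvdn_pcharf (pchar_Fp pr_p)) natrD natrX.
by rewrite natr_Zp Ec.
Qed.

(** A square root of [-d] in an algebraic closure that is fixed by Frobenius lies in the prime
    field, hence gives one modulo [p]. *)
Lemma neg_is_square_mod (p d : nat) :
  prime p ->
  (forall K : closedFieldType, p \in [pchar K] ->
     exists2 x : K, x ^+ p = x & x ^+ 2 + d%:R = 0) ->
  exists c : nat, (p %| c ^ 2 + d)%N.
Proof.
move=> pr_p sqK; have [K [f pK]] := Fp_closure _ pr_p.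
have [x xp x2] := sqK K pK.
have [|c Ec] := frobenius_fixed _ _ f x; first by rewrite card_Fp.
exists c; apply: dvdn_of_Fp => //; apply: (fmorph_inj f).
by rewrite rmorphD rmorphXn /= rmorph_nat rmorph0 -Ec.
Qed.

Lemma neg7_square_mod (p : nat) : prime p -> (p %% 7 = 4)%N ->
  exists c : nat, (p %| c ^ 2 + 7)%N.
Proof.
move=> pr_p p4; apply: neg_is_square_mod => // K pK.
have [z z0] := root_exists K 5.
have zk k : z ^+ k = z ^+ (k %% 7) by rewrite (expr_mod _ (cyclotomic_period _ _ _ z0)).
have [phi phiE] : exists phi : {rmorphism K -> K}, forall x, phi x = x ^+ p.
  by exists (pFrobenius_aut pK).
have zp : phi z = z ^+ 4 by rewrite phiE (zk p) p4.
(* With [a] the sum of the [z ^+ r] over the nonzero squares [r] modulo 7, stable under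
   [z |-> z ^+ 4], [2 a + 1] is the quadratic Gauss sum, of square [-7]. *)
exists (2%:R * (z + z ^+ 2 + z ^+ 4) + 1).
  rewrite -phiE !(rmorphD, rmorphM, rmorphXn, rmorph1, rmorph_nat) zp.
  rewrite -!exprM (zk 8%N) (zk 16%N) expr1; ring.
(* The cofactor is the quotient in the division by the cyclotomic polynomial. *)
have -> : (2%:R * (z + z ^+ 2 + z ^+ 4) + 1) ^+ 2 + 7%:R =
   4%:R * (z ^+ 2 - z + 2%:R) * (\sum_(i < 7) z ^+ i) :> K.
  by rewrite !big_ord_recl big_ord0 /=; ring.
by rewrite z0 mulr0.
Qed.

Lemma neg22_square_mod (p : nat) : prime p -> (p %% 11 = 4)%N -> (p %% 8 = 1)%N ->
  exists c : nat, (p %| c ^ 2 + 22)%N.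
Proof.
move=> pr_p p4 p1; apply: neg_is_square_mod => // K pK.
have [z z0] := root_exists K 9.
have zk k : z ^+ k = z ^+ (k %% 11) by rewrite (expr_mod _ (cyclotomic_period _ _ _ z0)).
have [phi phiE] : exists phi : {rmorphism K -> K}, forall x, phi x = x ^+ p.
  by exists (pFrobenius_aut pK).
have zp : phi z = z ^+ 4 by rewrite phiE (zk p) p4.
have [w w4] : exists w : K, w ^+ 4 = -1.
  have /closed_rootP [w] : size ('X^4 + 1%:P : {poly K}) != 1 by rewrite size_XnaddC.
  by rewrite rootE !hornerE addr_eq0 => /eqP; exists w.
(* [w] is an eighth root of unity and [p] is 1 modulo 8. *)
have wp : phi w = w.
  rewrite phiE -(@expr_mod _ 8 w) ?p1 ?expr1 //.
  by rewrite (exprM w 4 2) w4 sqrrN expr1n.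
(* The Gauss sum modulo 11, of square [-11], times [w + w^-1], of square [2]. *)
exists ((2%:R * (z + z ^+ 3 + z ^+ 4 + z ^+ 5 + z ^+ 9) + 1) * (w - w ^+ 3)).
  rewrite -phiE !(rmorphD, rmorphN, rmorphM, rmorphXn, rmorph1, rmorph_nat) zp wp.
  rewrite -!exprM (zk 12%N) (zk 16%N) (zk 20%N) (zk 36%N) expr1; congr (_ * _); ring.
(* With [G] and [H] the two factors, [G^2 H^2 + 22 = (G^2 + 11) H^2 - 11 (H^2 - 2)], where
   [G^2 + 11] is a multiple of the cyclotomic sum and [H^2 - 2 = (w^2 - 2) (w^4 + 1)]. *)
have -> : ((2%:R * (z + z ^+ 3 + z ^+ 4 + z ^+ 5 + z ^+ 9) + 1) * (w - w ^+ 3)) ^+ 2 + 22%:R =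
   4%:R * (z ^+ 8 - z ^+ 7 + 2%:R * z ^+ 4 - 2%:R * z + 3%:R)
        * (\sum_(i < 11) z ^+ i) * (w - w ^+ 3) ^+ 2
   - 11%:R * (w ^+ 2 - 2%:R) * (w ^+ 4 + 1) :> K.
  by rewrite !big_ord_recl big_ord0 /=; ring.
by rewrite z0 w4 addNr !(mulr0, mul0r) subr0.
Qed.

Lemma prime_Z_to_nat (p : Z) : Znumtheory.prime p -> prime (Z.to_nat p).
Proof.
move=> pr_p; have p2 := prime_ge_2 p pr_p.
apply/primeP; split; first by apply/ltP; lia.
move=> d /dvdnP [k Ek]; have : Z.divide (Z.of_nat d) p.
  by exists (Z.of_nat k); rewrite -Nat2Z.inj_mul -[Nat.mul _ _]Ek Z2Nat.id; lia.
by case/(prime_divisors p pr_p) => [|[|[|]]] Ed; apply/orP;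
  [lia | left; apply/eqP; lia | right; apply/eqP; lia | lia].
Qed.

Lemma modn_Z_to_nat (p : Z) (m r : nat) :
  Z.le 0 p -> Z.modulo p (Z.of_nat m.+1) = Z.of_nat r -> (Z.to_nat p %% m.+1 = r)%N.
Proof.
move=> p0 Er; have := Z.mod_pos_bound p (Z.of_nat m.+1) ltac:(lia); rewrite Er => rm.
have Ep := Z.div_mod p (Z.of_nat m.+1) ltac:(lia); rewrite Er in Ep.
have -> : Z.to_nat p = (Z.to_nat (Z.div p (Z.of_nat m.+1)) * m.+1 + r)%N.
  have q0 := Z.div_pos p (Z.of_nat m.+1) p0 ltac:(lia).
  by rewrite -multE -plusE; nia.
by rewrite modnMDl modn_small //; apply/ltP; lia.
Qed.

Lemma divide_of_dvdn (p : Z) (c d : nat) : Z.le 0 p -> (Z.to_nat p %| c ^ 2 + d)%N ->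
  Z.divide p (Z.add (Z.pow (Z.of_nat c) 2) (Z.of_nat d)).
Proof.
move=> p0 /dvdnP [k]; rewrite -mulnn -multE -plusE => Ek; exists (Z.of_nat k).
by rewrite Z.pow_2_r -Nat2Z.inj_mul -Nat2Z.inj_add Ek Nat2Z.inj_mul Z2Nat.id.
Qed.

End QuadraticResidues.

Import QuadraticResidues.

Lemma neg7_square_mod_prime (p : Z) : prime p -> p mod 7 = 4 ->
  exists c : Z, (p | c ^ 2 + 7).
Proof.
intros Hp H7; pose proof (prime_ge_2 p Hp).
destruct (neg7_square_mod (Z.to_nat p)) as [c Hc].
- now apply prime_Z_to_nat.
- apply (modn_Z_to_nat p 6 4); [lia|exact H7].
- exists (Z.of_nat c); apply (divide_of_dvdn p c 7); [lia|exact Hc].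
Qed.

Lemma neg22_square_mod_prime (p : Z) : prime p -> p mod 11 = 4 -> p mod 8 = 1 ->
  exists c : Z, (p | c ^ 2 + 22).
Proof.
intros Hp H11 H8; pose proof (prime_ge_2 p Hp).
destruct (neg22_square_mod (Z.to_nat p)) as [c Hc].
- now apply prime_Z_to_nat.
- apply (modn_Z_to_nat p 10 4); [lia|exact H11].
- apply (modn_Z_to_nat p 7 1); [lia|exact H8].
- exists (Z.of_nat c); apply (divide_of_dvdn p c 22); [lia|exact Hc].
Qed.

(** * Reduction of binary quadratic forms *)

(** Gauss reduction, by descent on [a]: a shift of [x] by a multiple of [y] makes the middle
    coefficient small, and if the last coefficient is then below [a], the variables are swapped. *)
Lemma reduced_form (D : Z) : 0 < D -> forall a b c x y : Z, 0 < a -> a * c - b ^ 2 = D ->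
  exists A B C X Y : Z,
    A * C - B ^ 2 = D /\ 0 < A <= C /\ -A <= 2 * B <= A /\
    a * x ^ 2 + 2 * b * x * y + c * y ^ 2 = A * X ^ 2 + 2 * B * X * Y + C * Y ^ 2.
Proof.
intros HD a; induction (Zwf_well_founded 0 a) as [a _ IH]; unfold Zwf in IH.
intros b c x y Ha Hdet.
(* The integer nearest to [b / a]. *)
set (k := (2 * b + a) / (2 * a)).
set (b' := b - k * a).
set (c' := c - 2 * k * b + k ^ 2 * a).
assert (Hb : - a <= 2 * b' <= a).
{ pose proof (Z.div_mod (2 * b + a) (2 * a) ltac:(lia)) as E.
  pose proof (Z.mod_pos_bound (2 * b + a) (2 * a) ltac:(lia)) as M.
  fold k in E; unfold b'; lia. }
assert (Hdet' : a * c' - b' ^ 2 = D) by (rewrite <- Hdet; unfold b', c'; ring).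
assert (Hform : a * x ^ 2 + 2 * b * x * y + c * y ^ 2
  = a * (x + k * y) ^ 2 + 2 * b' * (x + k * y) * y + c' * y ^ 2)
  by (unfold b', c'; ring).
clearbody k b' c'; clear Hdet.
destruct (Z_le_gt_dec a c') as [Hac|Hac].
- exists a, b', c', (x + k * y), y; split; [assumption|]; split; [lia|]; split; assumption.
- assert (Hc : 0 < c').
  { clear - HD Ha Hdet'; pose proof (Z.pow_even_nonneg b' 2 ltac:(now exists 1)).
    apply (Z.mul_pos_cancel_l a); lia. }
  (* The swap sends [(x, y)] to [(y, -x)], which negates the middle coefficient. *)
  destruct (IH c' ltac:(split; lia) (- b') a y (- (x + k * y)) Hc) as
    (A & B & C & X & Y & H1 & H2 & H3 & H4); [rewrite <- Hdet'; ring|].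
  exists A, B, C, X, Y; split; [|split; [|split]]; try assumption.
  rewrite Hform, <- H4; ring.
Qed.

(** If [c ^ 2 + D = k * p], the form with coefficients [p], [2 * c], [k] has determinant [D] and
    value [p] at [(1, 0)]. Once reduced, [4 * B ^ 2 <= A ^ 2 <= A * C] bounds [A]. *)
Lemma divisor_reduced_form (D p c : Z) : 0 < D -> 0 < p -> (p | c ^ 2 + D) ->
  exists A B C X Y : Z,
    A * C - B ^ 2 = D /\ 0 < A <= C /\ -A <= 2 * B <= A /\ 3 * A ^ 2 <= 4 * D /\
    p = A * X ^ 2 + 2 * B * X * Y + C * Y ^ 2.
Proof.
intros HD Hp [k Hk].
destruct (reduced_form D HD p c k 1 0 Hp) as (A & B & C & X & Y & H1 & H2 & H3 & H4); [lia|].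
assert (4 * B ^ 2 <= A ^ 2) by (clear - H3; nia).
assert (A ^ 2 <= A * C) by (clear - H2; nia).
assert (H4' : p = A * X ^ 2 + 2 * B * X * Y + C * Y ^ 2) by (rewrite <- H4; ring).
exists A, B, C, X, Y; split; [|split; [|split; [|split]]]; try assumption; lia.
Qed.

(** The other reduced forms of determinant 7 are [2 X^2 + 2 X Y + 4 Y^2] and its mirror image, with
    even values only. *)
Lemma sq_add_7sq (p c : Z) : 0 < p -> p mod 2 = 1 -> (p | c ^ 2 + 7) ->
  exists x y : Z, p = x ^ 2 + 7 * y ^ 2.
Proof.
intros Hp Hodd Hdiv.
destruct (divisor_reduced_form 7 p c ltac:(lia) Hp Hdiv) as
  (A & B & C & X & Y & H1 & H2 & H3 & H4 & ->).
assert (HA : A <= 3) by nia.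
assert (HB : B = 0 \/ B = 1 \/ B = -1) by lia.
assert (HA' : A = 1 \/ A = 2 \/ A = 3) by lia.
destruct HA' as [->|[->| ->]], HB as [->|[->| ->]]; try lia.
- exists X, Y; replace C with 7 by lia; ring.
- replace (_ + _) with ((X ^ 2 + X * Y + 2 * Y ^ 2) * 2) in Hodd by (replace C with 4 by lia; ring).
  now rewrite Z_mod_mult in Hodd.
- replace (_ + _) with ((X ^ 2 - X * Y + 2 * Y ^ 2) * 2) in Hodd by (replace C with 4 by lia; ring).
  now rewrite Z_mod_mult in Hodd.
Qed.

Lemma sq_mod_8 (x : Z) : x ^ 2 mod 8 = 0 \/ x ^ 2 mod 8 = 1 \/ x ^ 2 mod 8 = 4.
Proof.
rewrite Z.pow_2_r, Z.mul_mod by lia.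
pose proof (Z.mod_pos_bound x 8 ltac:(lia)).
assert (E : x mod 8 = 0 \/ x mod 8 = 1 \/ x mod 8 = 2 \/ x mod 8 = 3 \/
  x mod 8 = 4 \/ x mod 8 = 5 \/ x mod 8 = 6 \/ x mod 8 = 7) by lia.
intuition (match goal with H : x mod 8 = _ |- _ => rewrite H end; cbn; auto).
Qed.

(** The only other reduced form of determinant 22 is [2 X^2 + 11 Y^2], which is never 1 modulo 8. *)
Lemma sq_add_22sq (p c : Z) : 0 < p -> p mod 8 = 1 -> (p | c ^ 2 + 22) ->
  exists x y : Z, p = x ^ 2 + 22 * y ^ 2.
Proof.
intros Hp Hodd Hdiv.
destruct (divisor_reduced_form 22 p c ltac:(lia) Hp Hdiv) as
  (A & B & C & X & Y & H1 & H2 & H3 & H4 & ->).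
assert (HA : A <= 5) by nia.
assert (HB : B = 0 \/ B = 1 \/ B = -1 \/ B = 2 \/ B = -2) by lia.
assert (HA' : A = 1 \/ A = 2 \/ A = 3 \/ A = 4 \/ A = 5) by lia.
destruct HA' as [->|[->|[->|[->| ->]]]], HB as [->|[->|[->|[->| ->]]]]; try lia.
- exists X, Y; replace C with 22 by lia; ring.
- replace (_ + _) with (2 * X ^ 2 + 11 * Y ^ 2) in Hodd by (replace C with 11 by lia; ring).
  exfalso; pose proof (sq_mod_8 X) as HX; pose proof (sq_mod_8 Y) as HY; clear - Hodd HX HY.
  revert Hodd HX HY; generalize (X ^ 2), (Y ^ 2); intros; Z.div_mod_to_equations; lia.
Qed.

Lemma prime_mod_4 (p : Z) : prime p -> p mod 4 <> 0.
Proof.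
intros Hp H; pose proof (prime_ge_2 p Hp).
apply Z.mod_divide in H; [|lia]; destruct H as [k ->].
destruct (prime_divisors _ Hp 2) as [E|[E|[E|E]]]; try lia.
exists (2 * k); ring.
Qed.

Lemma prime_sq_add_7sq (p : Z) : prime p -> p mod 7 = 4 -> p mod 8 = 1 ->
  exists x y : Z, p = x ^ 2 + 7 * y ^ 2.
Proof.
intros Hp H7 H8; pose proof (prime_ge_2 p Hp).
destruct (neg7_square_mod_prime p Hp H7) as [c Hc].
apply (sq_add_7sq p c); [lia| |exact Hc].
Z.div_mod_to_equations; lia.
Qed.

Lemma prime_sq_add_22sq (p : Z) : prime p -> p mod 11 = 4 -> p mod 8 = 1 ->
  exists x y : Z, p = x ^ 2 + 22 * y ^ 2.
Proof.
intros Hp H11 H8; pose proof (prime_ge_2 p Hp).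
destruct (neg22_square_mod_prime p Hp H11 H8) as [c Hc].
apply (sq_add_22sq p c); [lia|exact H8|exact Hc].
Qed.

(** * From non-exceptional numbers to representations *)

Lemma not_exceptional (a n : Z) : 1 < n -> Z.gcd a n = 1 -> ~ exceptional a n ->
  exists p x : Z, prime p /\ n = p + a * x ^ 2.
Proof.
intros Hn Hgcd Hexc; apply NNPP; intros Hno; apply Hexc; split; [lia|split; [exact Hgcd|]].
intros p x Hp E; apply Hno; now exists p, x.
Qed.

Lemma odd_of_sq_mod_8 (x : Z) : x ^ 2 mod 8 = 1 -> exists y : Z, x = 2 * y + 1.
Proof.
intros H; exists (x / 2); pose proof (Z.div_mod x 2 ltac:(lia)) as E.
pose proof (Z.mod_pos_bound x 2 ltac:(lia)).
destruct (Z.eq_dec (x mod 2) 0) as [E0|E0]; [|lia].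
rewrite E0, Z.add_0_r in E; exfalso; rewrite E in H.
replace ((2 * (x / 2)) ^ 2) with (4 * (x / 2) ^ 2) in H by ring.
revert H; generalize ((x / 2) ^ 2); intros; Z.div_mod_to_equations; lia.
Qed.

Lemma even_of_sq_mod_4 (x : Z) : x ^ 2 mod 4 = 0 -> exists y : Z, x = 2 * y.
Proof.
intros H; exists (x / 2); pose proof (Z.div_mod x 2 ltac:(lia)) as E.
pose proof (Z.mod_pos_bound x 2 ltac:(lia)).
destruct (Z.eq_dec (x mod 2) 0) as [E0|E0]; [lia|].
replace (x mod 2) with 1 in E by lia; exfalso; rewrite E in H.
replace ((2 * (x / 2) + 1) ^ 2) with (4 * ((x / 2) ^ 2 + x / 2) + 1) in H by ring.
revert H; generalize ((x / 2) ^ 2 + x / 2); intros; Z.div_mod_to_equations; lia.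
Qed.

(** The square roots of 11 modulo 14 are 5 and -5, and the sign of [w] is free. The shape
    [14 * z - 5] comes from [56 p_9(z) = (14 z - 5)^2 - 25]. *)
Lemma sqrt_11_mod_14 (w : Z) : w ^ 2 mod 14 = 11 ->
  exists z : Z, w ^ 2 = (14 * z - 5) ^ 2.
Proof.
intros H; pose proof (Z.div_mod w 14 ltac:(lia)) as E.
pose proof (Z.mod_pos_bound w 14 ltac:(lia)) as B.
assert (R : w mod 14 = 9 \/ w mod 14 = 5).
{ rewrite Z.pow_2_r, Z.mul_mod in H by lia.
  assert (C : forall r, 0 <= r < 14 -> (r * r) mod 14 = 11 -> r = 9 \/ r = 5).
  { intros r Hr; assert (D : In r (map Z.of_nat (seq 0 14)))
      by (apply in_map_iff; exists (Z.to_nat r); rewrite in_seq; lia).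
    cbn in D; intuition (subst; cbn in *; try discriminate; auto). }
  now apply C. }
destruct R as [R|R]; rewrite R in E; rewrite E.
- exists (w / 14 + 1); ring.
- exists (- (w / 14)); ring.
Qed.

(** Here the roots are 9 and -9, and [88 p_13(z) = (22 z - 9)^2 - 81]. *)
Lemma sqrt_15_mod_22 (w : Z) : w ^ 2 mod 22 = 15 ->
  exists z : Z, w ^ 2 = (22 * z - 9) ^ 2.
Proof.
intros H; pose proof (Z.div_mod w 22 ltac:(lia)) as E.
pose proof (Z.mod_pos_bound w 22 ltac:(lia)) as B.
assert (R : w mod 22 = 13 \/ w mod 22 = 9).
{ rewrite Z.pow_2_r, Z.mul_mod in H by lia.
  assert (C : forall r, 0 <= r < 22 -> (r * r) mod 22 = 15 -> r = 13 \/ r = 9).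
  { intros r Hr; assert (D : In r (map Z.of_nat (seq 0 22)))
      by (apply in_map_iff; exists (Z.to_nat r); rewrite in_seq; lia).
    cbn in D; intuition (subst; cbn in *; try discriminate; auto). }
  now apply C. }
destruct R as [R|R]; rewrite R in E; rewrite E.
- exists (w / 22 + 1); ring.
- exists (- (w / 22)); ring.
Qed.

Lemma represented_of_not_exceptional_7 (n : Z) : 0 <= n -> ~ exceptional 7 (56 * n + 32) ->
  exists x y z : Z, n = 1 * polygonal 3 x + 2 * polygonal 4 y + 1 * polygonal 9 z.
Proof.
intros Hn Hexc.
destruct (not_exceptional 7 (56 * n + 32)) as (p & X & Hp & E); [lia| |exact Hexc|].
{ apply Z.bezout_1_gcd; exists (- (16 * n + 9)), 2; ring. }
pose proof (prime_mod_4 p Hp) as Hp4.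
(* Modulo 8, [p] is congruent to [X ^ 2]; an even [X] would make 4 divide [p]. *)
assert (HX : X ^ 2 mod 8 = 1).
{ pose proof (sq_mod_8 X) as HX; revert HX E; generalize (X ^ 2); intros.
  Z.div_mod_to_equations; lia. }
destruct (odd_of_sq_mod_8 X HX) as [x ->].
destruct (prime_sq_add_7sq p Hp) as (w & v & Ep).
{ revert E; generalize ((2 * x + 1) ^ 2); intros; Z.div_mod_to_equations; lia. }
{ revert E HX; generalize ((2 * x + 1) ^ 2); intros; Z.div_mod_to_equations; lia. }
(* Modulo 8, [w ^ 2 - v ^ 2] is 1 and squares are 0, 1 or 4. Halving [v] twice then uses this
   congruence each time. *)
assert (Hv : v ^ 2 mod 8 = 0).
{ pose proof (sq_mod_8 w) as A; pose proof (sq_mod_8 v) as B.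
  revert A B E Ep HX; generalize (w ^ 2), (v ^ 2), ((2 * x + 1) ^ 2).
  intros; Z.div_mod_to_equations; lia. }
destruct (even_of_sq_mod_4 v) as [u ->].
{ revert Hv; generalize (v ^ 2); intros; Z.div_mod_to_equations; lia. }
destruct (even_of_sq_mod_4 u) as [y ->].
{ replace ((2 * u) ^ 2) with (4 * u ^ 2) in Hv by ring.
  pose proof (sq_mod_8 u) as A; revert A Hv; generalize (u ^ 2); intros.
  Z.div_mod_to_equations; lia. }
replace ((2 * (2 * y)) ^ 2) with (16 * y ^ 2) in * by ring.
destruct (sqrt_11_mod_14 w) as [z Ez].
{ revert E Ep HX; generalize (w ^ 2), (y ^ 2), ((2 * x + 1) ^ 2).
  intros; Z.div_mod_to_equations; lia. }
exists x, y, z.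
pose proof (polygonal_double 3 x); pose proof (polygonal_double 4 y).
pose proof (polygonal_double 9 z); rewrite Ep, Ez in E; lia.
Qed.

Lemma represented_of_not_exceptional_11 (n : Z) : 0 <= n -> ~ exceptional 11 (88 * n + 92) ->
  exists x y z : Z, n = 1 * polygonal 3 x + 1 * polygonal 4 y + 1 * polygonal 13 z.
Proof.
intros Hn Hexc.
destruct (not_exceptional 11 (88 * n + 92)) as (p & X & Hp & E); [lia| |exact Hexc|].
{ apply Z.bezout_1_gcd; exists (- (24 * n + 25)), 3; ring. }
pose proof (prime_mod_4 p Hp) as Hp4.
(* Modulo 8, [p] is [4 - 3 X^2]; an even [X] would again make 4 divide [p]. *)
assert (HX : X ^ 2 mod 8 = 1).
{ pose proof (sq_mod_8 X) as HX; revert HX E; generalize (X ^ 2); intros.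
  Z.div_mod_to_equations; lia. }
destruct (odd_of_sq_mod_8 X HX) as [x ->].
destruct (prime_sq_add_22sq p Hp) as (w & v & Ep).
{ revert E; generalize ((2 * x + 1) ^ 2); intros; Z.div_mod_to_equations; lia. }
{ revert E HX; generalize ((2 * x + 1) ^ 2); intros; Z.div_mod_to_equations; lia. }
destruct (even_of_sq_mod_4 v) as [y ->].
{ pose proof (sq_mod_8 w) as A; pose proof (sq_mod_8 v) as B.
  revert A B E Ep HX; generalize (w ^ 2), (v ^ 2), ((2 * x + 1) ^ 2).
  intros; Z.div_mod_to_equations; lia. }
replace ((2 * y) ^ 2) with (4 * y ^ 2) in * by ring.
destruct (sqrt_15_mod_22 w) as [z Ez].
{ revert E Ep HX; generalize (w ^ 2), (y ^ 2), ((2 * x + 1) ^ 2).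
  intros; Z.div_mod_to_equations; lia. }
exists x, y, z.
pose proof (polygonal_double 3 x); pose proof (polygonal_double 4 y).
pose proof (polygonal_double 13 z); rewrite Ep, Ez in E; lia.
Qed.

(** * Verification of the small cases by computation *)

(* Unlike [map Z.of_nat (seq a len)], evaluated in linear time. *)
Fixpoint zseq (a : Z) (len : nat) : list Z :=
  match len with
  | O => []
  | S len => a :: zseq (a + 1) len
  end.

Lemma in_zseq (a n : Z) (len : nat) : In n (zseq a len) <-> a <= n < a + Z.of_nat len.
Proof. revert a; induction len as [|len IH]; intros a; cbn [zseq In]; [|rewrite IH]; lia. Qed.

Definition range (N : Z) : list Z := zseq 0 (Z.to_nat N).

Definition two_term_values (b X Y : Z) : list Z :=
  let squares := map (fun y => b * polygonal 4 y) (range Y) in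
  flat_map (fun t => map (Z.add t) squares) (map (polygonal 3) (range X)).

Lemma two_term_values_inv (b X Y v : Z) : In v (two_term_values b X Y) ->
  exists x y : Z, 0 <= x /\ v = polygonal 3 x + b * polygonal 4 y.
Proof.
intros Hv; apply in_flat_map in Hv as (t & Ht & Hv).
apply in_map_iff in Ht as (x & <- & Hx); apply in_zseq in Hx.
apply in_map_iff in Hv as (u & <- & Hu); apply in_map_iff in Hu as (y & <- & _).
exists x, y; split; [lia|reflexivity].
Qed.

(* Elements are shifted by one to be positive. *)
Definition lookup_table (l : list Z) : PositiveSet.t :=
  fold_right (fun v => PositiveSet.add (Z.to_pos (v + 1))) PositiveSet.empty l.

Lemma lookup_table_sound (l : list Z) (r : Z) : Forall (Z.le 0) l -> 0 <= r ->
  PositiveSet.mem (Z.to_pos (r + 1)) (lookup_table l) = true -> In r l.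
Proof.
intros Hl Hr Hmem; apply PositiveSet.mem_spec in Hmem; revert Hmem.
induction Hl as [|v l Hv _ IH]; cbn.
- intros H; now apply PositiveSet.empty_spec in H.
- intros H; apply PositiveSet.add_spec in H; destruct H as [H|H]; [left|right; auto].
  apply Z2Pos.inj in H; lia.
Qed.

Lemma two_term_values_nonneg (b X Y : Z) : 0 <= b -> Forall (Z.le 0) (two_term_values b X Y).
Proof.
intros Hb; apply Forall_forall; intros v Hv.
apply two_term_values_inv in Hv as (x & y & Hx & ->).
pose proof (polygonal_double 3 x); pose proof (polygonal_double 4 y); nia.
Qed.

(* [find] stops at the first hit also under call-by-value, unlike [existsb]. *)
Definition represented (T : PositiveSet.t) (l : list Z) (n : Z) : bool :=
  if find (fun v => let r := n - v in
                    if r <? 0 then false else PositiveSet.mem (Z.to_pos (r + 1)) T) l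
  then true else false.

Definition all_represented (b k X Y N : Z) : bool :=
  let T := lookup_table (two_term_values b X Y) in
  let l := map (polygonal k)
             (* Small [z] come first, so that the search usually ends early; [8] is large enough for
                both computations. *)
             [0; 1; -1; 2; -2; 3; -3; 4; -4; 5; -5; 6; -6; 7; -7; 8; -8] in
  forallb (represented T l) (range N).

Lemma all_represented_sound (b k X Y N : Z) : 0 <= b -> all_represented b k X Y N = true ->
  forall n : Z, 0 <= n < N ->
  exists x y z : Z, n = 1 * polygonal 3 x + b * polygonal 4 y + 1 * polygonal k z.
Proof.
intros Hb H n Hn; unfold all_represented in H; rewrite forallb_forall in H.
assert (Hin : In n (range N)) by (apply in_zseq; lia).
apply H in Hin; revert Hin; unfold represented.
destruct (find _ _) as [v|] eqn:Ev; [intros _|discriminate].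
apply find_some in Ev as [Hv Ez]; cbv zeta in Ez.
apply in_map_iff in Hv as (z & <- & _).
destruct (Z.ltb_spec (n - polygonal k z) 0) as [_|Hr]; [discriminate|].
apply lookup_table_sound in Ez; [|now apply two_term_values_nonneg|exact Hr].
apply two_term_values_inv in Ez as (x & y & _ & Ez).
exists x, y, z; lia.
Qed.

(** 2687 is the least [n] with [56 n + 32 > 150457]. The ranges 73 and 37 contain every nonnegative
    [x] and [y] with [p_3(x)] and [2 p_4(y)] below it. *)
Lemma all_represented_9 : all_represented 2 9 73 37 2687 = true.
Proof. vm_compute; reflexivity. Qed.

(** Likewise 8405 is the least [n] with [88 n + 92 > 739676], and 130 and 92 cut off [p_3(x)] and
    [p_4(y)] there. *)
Lemma all_represented_13 : all_represented 1 13 130 92 8405 = true.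
Proof. vm_compute; reflexivity. Qed.

Theorem theorem1p17
  (Hfin : forall a : Z, 0 < a -> ~ is_square a -> is_finite (exceptional a))
  (H6 : enumerated_by (exceptional 6) [])
  (H12 : enumerated_by (exceptional 12) [133])
  (H30 : enumerated_by (exceptional 30) [121])
  (H3 : enumerated_by (exceptional 3) [4; 28; 52; 133; 292; 892; 1588])
  (H18 : enumerated_by (exceptional 18) [187; 1003; 5777; 5993])
  (H24 : enumerated_by (exceptional 24)
           [25; 49; 145; 385; 745; 1081; 1139; 1561; 2119; 2449; 5299])
  (H5 : is_max (exceptional 5) 270086)
  (H7 : is_max (exceptional 7) 150457)
  (H8 : is_max (exceptional 8) 39167)
  (H10 : is_max (exceptional 10) 18031)
  (H11 : is_max (exceptional 11) 739676) :
  universal 1 2 1 3 4 9 /\ universal 1 1 1 3 4 13.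
Proof.
split; intros n Hn.
- destruct (Z_lt_le_dec n 2687) as [Hs|Hl].
  + exact (all_represented_sound 2 9 _ _ _ ltac:(lia) all_represented_9 n (conj Hn Hs)).
  + apply represented_of_not_exceptional_7; [exact Hn|].
    intros He; apply H7 in He; lia.
- destruct (Z_lt_le_dec n 8405) as [Hs|Hl].
  + exact (all_represented_sound 1 13 _ _ _ ltac:(lia) all_represented_13 n (conj Hn Hs)).
  + apply represented_of_not_exceptional_11; [exact Hn|].
    intros He; apply H11 in He; lia.
Qed.
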